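(* Let $X$ be a Banach space over $\mathbb{K}\in\{\mathbb{R},\mathbb{C}\}$ and let $A:\mathbb{K}\to\mathbb{L}_X$ be a map. The linear nonautonomous differential equation $\dot{x}(t)=A(t)x(t)$ on $X$ has an evolution operator associated to it if and only if $A$ is the infinitesimal generator of a differentiable cotranslation $Z:\mathbb{K}\times \mathbb{K}\to \mathbb{A}_X$.
   Context: $\mathbb{L}_X$ is the set of all linear operators $X\to X$; $\mathbb{B}_X$ is the Banach algebra of continuous linear operators $X\to X$ with the operator norm; $\mathbb{A}_X$ is the group of invertible elements of $\mathbb{B}_X$ with inverse in $\mathbb{B}_X$, with the subspace topology. For $\varphi:\mathbb{K}\times\mathbb{K}\to\mathbb{B}_X$, $\partial_1\varphi(r,t)=\lim_{h\to0}\frac{\varphi(r+h,t)-\varphi(r,t)}{h}$ and $\partial_2\varphi(r,t)=\lim_{h\to0}\frac{\varphi(r,t+h)-\varphi(r,t)}{h}$ (limits in $\mathbb{B}_X$). A cotranslation is a map $Z:\mathbb{K}\times\mathbb{K}\to\mathbb{A}_X$ such that $Z(r,t+s)=Z(s+r,t)\,Z(r,s)$ for all $r,s,t\in\mathbb{K}$. It is differentiable if it is differentiable as a two-variable function into $\mathbb{B}_X$. The infinitesimal generator of a differentiable cotranslation $Z$ is the function $A:\mathbb{K}\to\mathbb{L}_X$, $A(t)=\partial_2Z(t,0)$. A map $\Psi:\mathbb{K}\times\mathbb{K}\to\mathbb{B}_X$ is an evolution operator if (i) $\Psi(r,r)=\mathrm{Id}$ and $\Psi(r,t)\Psi(t,s)=\Psi(r,s)$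 for all $r,s,t\in\mathbb{K}$; (ii) $(r,t)\mapsto[\Psi(r,t)](x)\in X$ is continuous for every $x\in X$. It is the evolution operator associated to $\dot{x}=A(t)x(t)$ if furthermore (iii) $\partial_1\Psi(r,t)=A(r)\Psi(r,t)$ and $\partial_2\Psi(r,t)=-\Psi(r,t)A(t)$ for all $r,t\in\mathbb{K}$. *)

(* Defs.v *)
From HB Require Import structures.
From mathcomp Require Import all_boot all_order all_algebra.
From mathcomp Require Import all_classical all_reals all_analysis.
From mathcomp.real_closed Require Import complex.

Set Implicit Arguments.
Unset Strict Implicit.
Unset Printing Implicit Defensive.

Import Order.TTheory GRing.Theory Num.Theory.
Import numFieldNormedType.Exports.

Local Open Scope classical_set_scope.
Local Open Scope ring_scope.

Variant scalar_kind := RealScalars | ComplexScalars.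

Definition scalars (R : realType) (k : scalar_kind) : numFieldType :=
  match k with
  | RealScalars => R
  | ComplexScalars => R[i]%C
  end.

Definition of_real (R : realType) (k : scalar_kind) : R -> scalars R k :=
  match k with
  | RealScalars => id
  | ComplexScalars => fun x => x%:C%C
  end.

Section OfReal.
Variables (R : realType) (k : scalar_kind).
Implicit Types (a b : R).

Lemma of_real0 : of_real k (0 : R) = 0. Proof. by case: k. Qed.

Lemma of_realD a b : of_real k (a + b) = of_real k a + of_real k b.
Proof. by case: k => //; exact: (rmorphD (real_complex R)). Qed.

Lemma of_realM a b : of_real k (a * b) = of_real k a * of_real k b.
Proof. by case: k => //; exact: (rmorphM (real_complex R)). Qed.

Lemma ler_of_real a b : (of_real k a <= of_real k b) = (a <= b).
Proof. by case: k => //; exact: lecR. Qed.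

Lemma of_real_ge0 a : (0 <= of_real k a) = (0 <= a).
Proof. by rewrite -of_real0 ler_of_real. Qed.

Lemma ge0_of_real (z : scalars R k) : 0 <= z ->
  exists2 a, 0 <= a & z = of_real k a.
Proof.
case: k z => /= z z0; first by exists z.
case: z z0 => a b; rewrite lecE/= => /andP[/eqP -> a0].
by exists a.
Qed.

End OfReal.

Section BoundedOperators.
Variables (R : realType) (k : scalar_kind).
Notation K := (scalars R k).
Variable X : normedModType K.

Definition continuous_linear : {pred X -> X} :=
  mem [set f : X -> X | linear f /\ continuous f].

Record bounded_op := BoundedOp {
  bop_fun :> X -> X;
  bop_prop : bop_fun \in continuous_linear }.

HB.instance Definition _ := [isSub for bop_fun].
HB.instance Definition _ := [Choice of bounded_op by <:].

Lemma bopP (f g : bounded_op) : f = g <-> f =1 g.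
Proof. by split=> [->//|fg]; exact/val_inj/funext. Qed.

Lemma bop_linear (f : bounded_op) : linear f.
Proof. by case: f => f /= /set_mem[]. Qed.

Lemma bop_continuous (f : bounded_op) : continuous f.
Proof. by case: f => f /= /set_mem[]. Qed.

HB.instance Definition _ (f : bounded_op) :=
  GRing.isLinear.Build K X X *:%R f (bop_linear f).

Lemma continuous_linear_submod : submod_closed continuous_linear.
Proof.
split.
  rewrite inE; split; last by move=> x; exact: cvg_cst.
  by move=> a u v; rewrite /GRing.zero/= scaler0 addr0.
move=> a f g; rewrite !inE => -[lf cf] [lg cg]; split.
  move=> b u v; change (a *: f (b *: u + v) + g (b *: u + v) =
    b *: (a *: f u + g u) + (a *: f v + g v)).
  by rewrite lf lg !scalerDr !scalerA [b * a]mulrC addrACA.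
move=> x; apply: (@cvgD _ _ _ _ _ (fun y => a *: f y)); last exact: cg.
by apply: cvgZl_tmp; exact: cf.
Qed.

HB.instance Definition _ := GRing.isSubmodClosed.Build _ _ continuous_linear
  continuous_linear_submod.
HB.instance Definition _ := [SubChoice_isSubLmodule of bounded_op by <:].

Lemma bopD (f g : bounded_op) x : (f + g) x = f x + g x. Proof. by []. Qed.
Lemma bopZ (a : K) (f : bounded_op) x : (a *: f) x = a *: f x. Proof. by []. Qed.

Definition opnorm_bounds (f : bounded_op) : set R :=
  [set M | 0 <= M /\ forall x, `|f x| <= of_real k M * `|x|].

(* A norm on a normedModType K is K-valued, hence the embedding of_real. *)
Definition opnorm (f : bounded_op) : K := of_real k (inf (opnorm_bounds f)).

Lemma opnorm_bounds_lb (f : bounded_op) : has_lbound (opnorm_bounds f).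
Proof. by exists 0 => M []. Qed.

Lemma opnorm_bounds_neq0 (f : bounded_op) : opnorm_bounds f !=set0.
Proof.
have [_ /(_ (@bop_continuous f))] := linear_bounded_continuous f.
move=> /linear_boundedP /pinfty_ex_gt0[M M0 fM].
have [a a0 Ma] := ge0_of_real (ltW M0).
by exists a; split=> // x; rewrite -Ma; exact: fM.
Qed.

Lemma opnorm_le (f : bounded_op) M : opnorm_bounds f M -> opnorm f <= of_real k M.
Proof. by move=> fM; rewrite ler_of_real ge_inf//; exact: opnorm_bounds_lb. Qed.

Lemma inf_opnorm_ge0 (f : bounded_op) : 0 <= inf (opnorm_bounds f).
Proof. by apply: lb_le_inf => [|M []//]; exact: opnorm_bounds_neq0. Qed.

Lemma opnormP (f : bounded_op) x : `|f x| <= opnorm f * `|x|.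
Proof.
have [->|x0] := eqVneq x 0; first by rewrite linear0 !normr0 mulr0.
rewrite -ler_pdivrMr ?normr_gt0//.
have [a a0 fxa] := ge0_of_real (divr_ge0 (normr_ge0 (f x)) (normr_ge0 x)).
rewrite fxa ler_of_real; apply: lb_le_inf; first exact: opnorm_bounds_neq0.
move=> M [M0 fM]; rewrite -(ler_of_real k) -fxa ler_pdivrMr ?normr_gt0//.
Qed.

Lemma opnorm_bounds_inf (f : bounded_op) : opnorm_bounds f (inf (opnorm_bounds f)).
Proof. by split; [exact: inf_opnorm_ge0|exact: opnormP]. Qed.

Lemma ler_opnormD (f g : bounded_op) : opnorm (f + g) <= opnorm f + opnorm g.
Proof.
rewrite -of_realD; apply: opnorm_le; split.
  by rewrite addr_ge0// inf_opnorm_ge0.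
move=> x; rewrite of_realD mulrDl bopD (le_trans (ler_normD _ _))//.
by rewrite lerD// opnormP.
Qed.

Lemma ler_opnormZ (a : K) (f : bounded_op) : opnorm (a *: f) <= `|a| * opnorm f.
Proof.
have [b b0 ab] := ge0_of_real (normr_ge0 a).
rewrite ab -of_realM; apply: opnorm_le; split.
  by rewrite mulr_ge0// inf_opnorm_ge0.
move=> x; rewrite of_realM -ab bopZ normrZ -mulrA ler_wpM2l//.
exact: opnormP.
Qed.

Lemma opnormZ (a : K) (f : bounded_op) : opnorm (a *: f) = `|a| * opnorm f.
Proof.
have [->|a0] := eqVneq a 0.
  apply/eqP; rewrite eq_le ler_opnormZ normr0 mul0r.
  by rewrite of_real_ge0 inf_opnorm_ge0.
apply/eqP; rewrite eq_le ler_opnormZ/=.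
rewrite -ler_pdivlMl ?normr_gt0// -normfV.
by rewrite -{1}[f](scalerK a0) ler_opnormZ.
Qed.

Lemma opnorm0_eq0 (f : bounded_op) : opnorm f = 0 -> f = 0.
Proof.
move=> f0; apply/bopP => x; apply/eqP.
by rewrite -normr_le0 (le_trans (opnormP f x))// f0 mul0r.
Qed.

HB.instance Definition _ :=
  Lmodule_isNormed.Build K bounded_op ler_opnormD opnormZ opnorm0_eq0.

Lemma id_continuous_linear : (@idfun X) \in continuous_linear.
Proof. by rewrite inE; split => // x; exact: cvg_id. Qed.

Lemma comp_continuous_linear (f g : bounded_op) : f \o g \in continuous_linear.
Proof.
rewrite inE; split=> [a u v|x]; first by rewrite /= !linearP.
by apply: continuous_comp; exact: bop_continuous.
Qed.

Definition bop_one : bounded_op := BoundedOp id_continuous_linear.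
Definition bop_mul (f g : bounded_op) : bounded_op :=
  BoundedOp (comp_continuous_linear f g).

Fact bop_mulA : associative bop_mul.
Proof. by move=> f g h; apply/bopP. Qed.
Fact bop_mul1l : left_id bop_one bop_mul.
Proof. by move=> f; apply/bopP. Qed.
Fact bop_mul1r : right_id bop_one bop_mul.
Proof. by move=> f; apply/bopP. Qed.
Fact bop_mulDl : left_distributive bop_mul +%R.
Proof. by move=> f g h; apply/bopP. Qed.
Fact bop_mulDr : right_distributive bop_mul +%R.
Proof. by move=> f g h; apply/bopP => x; exact: (linearD f). Qed.

(* Only a pzRingType: the ring is trivial when X = 0. *)
HB.instance Definition _ := GRing.Zmodule_isPzRing.Build bounded_op
  bop_mulA bop_mul1l bop_mul1r bop_mulDl bop_mulDr.

Lemma bop_oneE x : (1 : bounded_op) x = x. Proof. by []. Qed.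
Lemma bop_mulE (f g : bounded_op) x : (f * g) x = f (g x). Proof. by []. Qed.

Record invertible_op := InvertibleOp {
  iop_op :> bounded_op;
  iop_prop : exists g : bounded_op, g * iop_op = 1 /\ iop_op * g = 1 }.

End BoundedOperators.

Section Dynamics.
Variables (R : realType) (k : scalar_kind).
Notation K := (scalars R k).
Variable X : normedModType K.
Implicit Types (phi Psi : K * K -> bounded_op X) (A : K -> {linear X -> X}).

Definition partial1 phi (r t : K) : bounded_op X :=
  derive1 (fun s => phi (s, t)) r.
Definition partial2 phi (r t : K) : bounded_op X :=
  derive1 (fun s => phi (r, s)) t.
Definition has_partial1 phi (r t : K) := derivable (fun s => phi (s, t)) r 1.
Definition has_partial2 phi (r t : K) := derivable (fun s => phi (r, s)) t 1.

Definition cotranslation (Z : K * K -> invertible_op X) :=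
  forall r s t : K,
    Z (r, t + s) = (Z (s + r, t) : bounded_op X) * (Z (r, s) : bounded_op X)
      :> bounded_op X.

Definition differentiable_map (Z : K * K -> invertible_op X) :=
  forall p : K * K, differentiable (fun q => Z q : bounded_op X) p.

Definition infinitesimal_generator (Z : K * K -> invertible_op X) (t : K) :
    bounded_op X :=
  partial2 (fun p => Z p : bounded_op X) t 0.

Definition evolution_operator Psi :=
  [/\ forall r, Psi (r, r) = 1,
      forall r t s, Psi (r, t) * Psi (t, s) = Psi (r, s)
    & forall x, continuous (fun p => Psi p x)].

(* A r and A t need not be continuous, so the equations are between maps. *)
Definition associated_evolution_operator A Psi :=
  evolution_operator Psi /\
  forall r t,
    [/\ has_partial1 Psi r t, has_partial2 Psi r t,
        forall x, partial1 Psi r t x = A r (Psi (r, t) x)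
      & forall x, partial2 Psi r t x = - Psi (r, t) (A t x)].

End Dynamics.

(* Main.v *)
(** The two notions correspond through Z(r,t) = Psi(r+t,r), i.e.
    Psi(r,t) = Z(t,r-t).

    From Psi to Z: since Psi(r+t,r) = Psi(r+t,0) Psi(0,r) is a product of two
    functions that are differentiable in one variable, Z is jointly
    differentiable, although only partial derivatives of Psi are given.

    From Z to Psi: Psi(r+h,t) - Psi(r,t) = (Z(r,h) - 1) Psi(r,t) and
    Psi(r,t+h) - Psi(r,t) = - Psi(r,t+h) (Z(t,h) - 1); dividing by h gives both
    differential equations, by norm continuity of Psi. *)

Require Import Defs.
From HB Require Import structures.
From mathcomp Require Import all_boot all_order all_algebra.
From mathcomp Require Import all_classical all_reals all_analysis.

Set Implicit Arguments.
Unset Strict Implicit.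
Unset Printing Implicit Defensive.

Import Order.TTheory GRing.Theory Num.Theory.
Import numFieldNormedType.Exports.

Local Open Scope classical_set_scope.
Local Open Scope ring_scope.

(** * Difference quotients and differentiability on the plane *)

Section Limits.
Context {K : numFieldType} {V : normedModType K}.

(** Since [derive1] is a total function, its value alone does not say that the derivative exists.
    One limit of difference quotients settles existence and value together. *)
Lemma derive1_cvgP (f : K -> V) (a : K) (l : V) :
  h^-1 *: (f (h + a) - f a) @[h --> 0^'] --> l <->
  derivable f a 1 /\ derive1 f a = l.
Proof.
have fE : (fun h => h^-1 *: ((f \o shift a) (h *: 1) - f a)) =
    (fun h => h^-1 *: (f (h + a) - f a)).
  by apply/funext => h; rewrite /= [h *: 1]mulr1.
rewrite /derivable fE; split=> [fl|[cf <-]]; last exact: cf.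
split; first by apply/cvg_ex; exists l.
by apply: cvg_lim fl; exact: norm_hausdorff.
Qed.

Lemma cvgr0_norm_dominated (T : Type) (F : set_system T) {FF : Filter F}
    (f : T -> V) (g : T -> K) :
  (forall x, `|f x| <= g x) -> g x @[x --> F] --> 0 -> f x @[x --> F] --> 0.
Proof.
move=> fg g0; apply/cvgr0Pnorm_lt => e e0.
apply: (filterS _ (cvgr0_norm_lt _ g0 _ e0)) => x; apply: le_lt_trans.
by rewrite ger0_norm// (le_trans _ (fg x)).
Qed.

Lemma differentiable_derivable_snd (f : K * K -> V) (r t : K) :
  differentiable f (r, t) -> derivable (fun s => f (r, s)) t 1.
Proof.
move=> df; apply/derivable1_diffP.
have dp : differentiable (fun s : K => (r, s)) t.
  by apply: differentiable_pair; [exact: differentiable_cst|exact: ex_diff].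
exact: (differentiable_comp dp).
Qed.

Lemma differentiable_comp_add (f : K -> V) (p : K * K) :
  differentiable f (p.1 + p.2) -> differentiable (fun q => f (q.1 + q.2)) p.
Proof.
move=> df; apply: (differentiable_comp (f := fun q : K * K => q.1 + q.2)) => //.
apply: (differentiableD (f := fst) (g := snd)).
- by apply: linear_differentiable => ?; exact: cvg_fst.
- by apply: linear_differentiable => ?; exact: cvg_snd.
Qed.

Lemma differentiable_comp_fst (f : K -> V) (p : K * K) :
  differentiable f p.1 -> differentiable (fun q => f q.1) p.
Proof.
move=> df; apply: (differentiable_comp (f := fun q : K * K => q.1)) => //.
by apply: linear_differentiable => ?; exact: cvg_fst.
Qed.

End Limits.

(** * Continuity and differentiability of products of bounded operators *)

Section BoundedOperatorLimits.
Context {R : realType} {k : scalar_kind} {X : normedModType (scalars R k)}.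
Notation K := (scalars R k).
Notation B := (bounded_op X).

Lemma opnormM (f g : B) : `|f * g| <= `|f| * `|g|.
Proof.
(* The infimum defining the operator norm is itself a bound, so the product of the two infima is a
   bound for [f * g]. *)
have [[a0 fa] [b0 gb]] := (opnorm_bounds_inf f, opnorm_bounds_inf g).
rewrite [`|f|]/(opnorm f) [`|g|]/(opnorm g) /opnorm -of_realM.
apply: opnorm_le; split=> [|x]; first exact: mulr_ge0.
by rewrite bop_mulE of_realM -mulrA (le_trans (fa _))// ler_wpM2l// of_real_ge0.
Qed.

Lemma bop_mul_bilinear :
  bilinear_for
    (GRing.Scale.Law.clone _ _ ( *:%R ) _)
    (GRing.Scale.Law.clone _ _ ( *:%R ) _)
    (@bop_mul R k X).
Proof.
split=> [f a u v|f a u v]; apply/bopP => x //.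
exact: linearP.
Qed.

HB.instance Definition _ := bilinear_isBilinear.Build K B B B _ _
  (@bop_mul R k X) bop_mul_bilinear.

Lemma bop_mul_continuous : continuous (fun p : B * B => bop_mul p.1 p.2).
Proof.
move=> [f g]; apply/subr_cvg0; apply: (cvgr0_norm_dominated (g :=
   fun p => `|p.1 - f| * `|p.2| + `|f| * `|p.2 - g|)) => [p|].
  have -> : bop_mul p.1 p.2 - bop_mul f g = (p.1 - f) * p.2 + f * (p.2 - g).
    by rewrite mulrBl mulrBr addrA subrK.
  by rewrite (le_trans (ler_normD _ _))// lerD// opnormM.
have h1 : p.1 @[p --> (f, g)] --> f by exact: cvg_fst.
have h2 : p.2 @[p --> (f, g)] --> g by exact: cvg_snd.
(* Writing 0 as the dominating expression evaluated at [(f, g)] lets the limit be computed factor by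
   factor. *)
rewrite -[X in _ --> X](_ : `|f - f| * `|g| + `|f| * `|g - g| = 0); last first.
  by rewrite !subrr !normr0 mul0r mulr0 addr0.
apply: cvgD; apply: cvgM.
- by apply: cvg_norm; apply: cvgB => //; exact: cvg_cst.
- exact: cvg_norm.
- exact: cvg_cst.
- by apply: cvg_norm; apply: cvgB => //; exact: cvg_cst.
Qed.

Lemma cvg_bop_mul (T : Type) (F : set_system T) {FF : Filter F}
    (f g : T -> B) (a b : B) :
  f @ F --> a -> g @ F --> b -> f x * g x @[x --> F] --> a * b.
Proof.
move=> fa gb.
exact: (cvg_comp (fun x => (f x, g x)) (fun p => bop_mul p.1 p.2)
  (cvg_pair fa gb) (@bop_mul_continuous (a, b))).
Qed.

Lemma bop_scalerAr (a : K) (f g : B) : f * (a *: g) = a *: (f * g).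
Proof. by apply/bopP => x; exact: linearZ. Qed.

Lemma bop_scalerAl (a : K) (f g : B) : (a *: f) * g = a *: (f * g).
Proof. exact/bopP. Qed.

(** The chain rule through the product, which is differentiable as a continuous bilinear map. *)
Lemma differentiable_bop_mul (V : normedModType K) (f g : V -> B) (x : V) :
  differentiable f x -> differentiable g x ->
  differentiable (fun y => f y * g y) x.
Proof.
move=> df dg.
apply: (@differentiable_comp _ _ _ _ (fun y => (f y, g y))
  (fun p => bop_mul p.1 p.2)); first exact: differentiable_pair.
exact/differentiable_bilin/bop_mul_continuous.
Qed.

(** By |g x - f x| <= |g - f| |x|, norm continuity implies the strong continuity demanded of an
    evolution operator. *)
Lemma bop_apply_continuous (x : X) : continuous (fun f : B => f x).
Proof.
move=> f; apply/(subr_cvg0 (F := nbhs f)); apply: (cvgr0_norm_dominated (g :=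
   fun g : B => `|g - f| * `|x|)) => [g|]; first exact: (opnormP (g - f) x).
rewrite -[X in _ --> X](mul0r `|x|) -(normr0 B) -(subrr f).
apply: cvgMl; apply: cvg_norm; apply: cvgB; [exact: cvg_id|exact: cvg_cst].
Qed.

End BoundedOperatorLimits.

(** * The correspondence between cotranslations and evolution operators *)

Section EvolutionOperators.
Context {R : realType} {k : scalar_kind} {X : normedModType (scalars R k)}.
Notation K := (scalars R k).
Notation B := (bounded_op X).
Implicit Types (A : K -> {linear X -> X}) (Z : K * K -> invertible_op X)
  (Psi : K * K -> B).

(** A left inverse cancels one factor of f f = f. The cotranslation law with both increments zero
    makes Z(r,0) such an idempotent. *)
Lemma invertible_idempotent (f : invertible_op X) :
  (f : B) * (f : B) = f :> B -> (f : B) = 1.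
Proof.
by case: f => f /= [g [gf _]] ff; rewrite -gf -[in RHS]ff mulrA gf mul1r.
Qed.

Lemma cotranslation_0 Z r : cotranslation Z -> (Z (r, 0) : B) = 1.
Proof.
by move=> /(_ r 0 0); rewrite !add0r => /esym/invertible_idempotent.
Qed.

Definition evolution_of_cotranslation Z (p : K * K) : B := Z (p.2, p.1 - p.2).

Lemma evolution_of_cotranslation_continuous Z : differentiable_map Z ->
  continuous (evolution_of_cotranslation Z).
Proof.
move=> dZ p; apply: (continuous_comp (f := fun p : K * K => (p.2, p.1 - p.2))
  (g := fun q => Z q : B)); last exact/differentiable_continuous.
have c1 : q.1 @[q --> p] --> p.1 by exact: cvg_fst.
have c2 : q.2 @[q --> p] --> p.2 by exact: cvg_snd.
exact: cvg_pair c2 (cvgB c1 c2).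
Qed.

Lemma evolution_of_cotranslationP Z : cotranslation Z -> differentiable_map Z ->
  evolution_operator (evolution_of_cotranslation Z).
Proof.
move=> cZ dZ; split=> [r|r t s|x].
- by rewrite /evolution_of_cotranslation subrr cotranslation_0.
(* The increments t - s and r - t lead from s to t and from t to r, so the cotranslation law reads
   Psi(r,s) = Psi(r,t) Psi(t,s). *)
- have := cZ s (t - s) (r - t).
  by rewrite /evolution_of_cotranslation addrA !subrK.
- move=> p; apply: (continuous_comp (f := evolution_of_cotranslation Z)
    (g := fun f : B => f x)); last exact: bop_apply_continuous.
  exact: evolution_of_cotranslation_continuous.
Qed.

Lemma infinitesimal_generator_cvg Z t :
  cotranslation Z -> differentiable_map Z ->
  h^-1 *: ((Z (t, h) : B) - 1) @[h --> 0^'] --> infinitesimal_generator Z t.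
Proof.
move=> cZ dZ; have dZt := differentiable_derivable_snd (dZ (t, 0)).
have [_ /(_ (conj dZt erefl))] :=
  derive1_cvgP (fun s => Z (t, s) : B) 0 (infinitesimal_generator Z t).
by under eq_fun do rewrite addr0 cotranslation_0//.
Qed.

Lemma evolution_of_cotranslation_partial1 Z r t :
  cotranslation Z -> differentiable_map Z ->
  has_partial1 (evolution_of_cotranslation Z) r t /\
  partial1 (evolution_of_cotranslation Z) r t =
    infinitesimal_generator Z r * evolution_of_cotranslation Z (r, t).
Proof.
move=> cZ dZ; have [_ PsiM _] := evolution_of_cotranslationP cZ dZ.
apply/derive1_cvgP.
under eq_fun => h.
  (* Passing through the time r, Psi(h+r,t) = Psi(h+r,r) Psi(r,t) with Psi(h+r,r) = Z(r,h). The
     right factor is constant in h. *)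
  rewrite -(PsiM _ r t) -[X in _ - X]mul1r -mulrBl -bop_scalerAl.
  rewrite {1}/evolution_of_cotranslation /= addrK.
  over.
by apply: cvg_bop_mul; [exact: infinitesimal_generator_cvg|exact: cvg_cst].
Qed.

Lemma evolution_of_cotranslation_partial2 Z r t :
  cotranslation Z -> differentiable_map Z ->
  has_partial2 (evolution_of_cotranslation Z) r t /\
  partial2 (evolution_of_cotranslation Z) r t =
    - (evolution_of_cotranslation Z (r, t) * infinitesimal_generator Z t).
Proof.
move=> cZ dZ; have [_ PsiM _] := evolution_of_cotranslationP cZ dZ.
apply/derive1_cvgP.
under eq_fun => h.
  (* Here Psi(r,t) = Psi(r,h+t) Psi(h+t,t) with Psi(h+t,t) = Z(t,h). The left factor still moves
     with h, and its limit comes from the norm continuity of Psi. *)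
  rewrite -(PsiM r (h + t) t) -[X in X - _]mulr1 -mulrBr -opprB mulrN scalerN.
  rewrite -bop_scalerAr {2}/evolution_of_cotranslation /= addrK.
  over.
apply: cvgN; apply: cvg_bop_mul; last exact: infinitesimal_generator_cvg.
have ht : h + t @[h --> 0^'] --> t.
  rewrite -[X in _ --> X]add0r; apply: cvgD; last exact: cvg_cst.
  exact: nbhs_dnbhs.
exact: (cvg_comp (fun h => (r, h + t)) (evolution_of_cotranslation Z)
  (cvg_pair (cvg_cst r) ht)
  (@evolution_of_cotranslation_continuous Z dZ (r, t))).
Qed.

Lemma evolution_operatorK Psi r t : evolution_operator Psi ->
  Psi (r, t) * Psi (t, r) = 1.
Proof. by case=> Psi1 PsiM _; rewrite PsiM Psi1. Qed.

Definition cotranslation_of_evolution Psi (ePsi : evolution_operator Psi)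
    (p : K * K) : invertible_op X :=
  InvertibleOp (ex_intro (fun g => g * Psi (p.1 + p.2, p.1) = 1 /\
      Psi (p.1 + p.2, p.1) * g = 1)
    (Psi (p.1, p.1 + p.2))
    (conj (evolution_operatorK _ _ ePsi) (evolution_operatorK _ _ ePsi))).

Lemma cotranslation_of_evolutionP Psi (ePsi : evolution_operator Psi) :
  cotranslation (cotranslation_of_evolution ePsi).
Proof.
move=> r s t /=; have [_ PsiM _] := ePsi.
by rewrite [r + s]addrC PsiM [t + s]addrC addrA [r + s]addrC.
Qed.

Lemma cotranslation_of_evolution_differentiable A Psi
    (aPsi : associated_evolution_operator A Psi) :
  differentiable_map (cotranslation_of_evolution aPsi.1).
Proof.
move=> p /=; have [[_ PsiM _] dPsi] := aPsi.
(* Passing through the fixed time 0 leaves factors that depend only on [p.1 + p.2] and only on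
   [p.1]. For one scalar variable, derivability is already differentiability. *)
under eq_fun do rewrite -(PsiM _ 0 _).
apply: differentiable_bop_mul.
- apply: (differentiable_comp_add (f := fun s => Psi (s, 0))).
  by apply/derivable1_diffP; have [] := dPsi (p.1 + p.2) 0.
- apply: (differentiable_comp_fst (f := fun s => Psi (0, s))).
  by apply/derivable1_diffP; have [] := dPsi 0 p.1.
Qed.

(** Z(t,h) - Z(t,0) = Psi(t+h,t) - Psi(t,t), so the generator at t is the first partial derivative
    of Psi at (t,t), that is, A(t) Psi(t,t) = A(t). The equality is pointwise because [A t] is not
    assumed bounded; it follows that it is. *)
Lemma cotranslation_of_evolution_generator A Psi
    (aPsi : associated_evolution_operator A Psi) t :
  A t =1 infinitesimal_generator (cotranslation_of_evolution aPsi.1) t.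
Proof.
move=> x; have [[Psi1 _ _] dPsi] := aPsi; have [d1 _ p1 _] := dPsi t t.
have /derive1_cvgP Psi_cvg := conj d1 (erefl (partial1 Psi t t)).
suff [_] : has_partial2 (fun p => Psi (p.1 + p.2, p.1)) t 0 /\
    partial2 (fun p => Psi (p.1 + p.2, p.1)) t 0 = partial1 Psi t t.
  by rewrite /infinitesimal_generator /= => ->; rewrite p1 Psi1.
apply/derive1_cvgP; under eq_fun do rewrite /= !addr0 [t + _]addrC.
exact: Psi_cvg.
Qed.

End EvolutionOperators.

Theorem theorem4p14 (R : realType) (k : scalar_kind)
    (X : completeNormedModType (scalars R k))
    (A : scalars R k -> {linear X -> X}) :
  (exists Psi : scalars R k * scalars R k -> bounded_op X,
     associated_evolution_operator A Psi) <->
  (exists Z : scalars R k * scalars R k -> invertible_op X,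
     [/\ cotranslation Z, differentiable_map Z
       & forall t, A t =1 infinitesimal_generator Z t]).
Proof.
split=> [[Psi aPsi]|[Z [cZ dZ AZ]]].
  exists (cotranslation_of_evolution aPsi.1); split.
  - exact: cotranslation_of_evolutionP.
  - exact: cotranslation_of_evolution_differentiable.
  - exact: cotranslation_of_evolution_generator.
exists (evolution_of_cotranslation Z).
split=> [|r t]; first exact: evolution_of_cotranslationP.
have [d1 p1] := evolution_of_cotranslation_partial1 r t cZ dZ.
have [d2 p2] := evolution_of_cotranslation_partial2 r t cZ dZ.
by split=> // x; rewrite AZ ?p1 ?p2.
Qed.
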